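(* For every numbering $\phi$ with the Kolmogorov property and every positive integer $k$, the set $\mathrm{MIN}_\phi$ is not $(1,k)$-recursive.
   Context: A numbering $\phi$ is given by a partial-recursive function $U:\mathbb{N}^2\to\mathbb{N}$ via $\phi_e(x)=U(e,x)$. $\phi$ has the Kolmogorov property if for every numbering $\psi$ there exist a constant $c>0$ and a (not necessarily computable) function $f$ with $f(e)\le ce+c$ and $\phi_{f(e)}=\psi_e$ for all $e$. $\mathrm{MIN}_\phi=\{e:(\forall j<e)\,[\phi_j\ne\phi_e]\}$. A set $A$ is $(1,k)$-recursive if there is a computable function $f$ mapping $k$-tuples to label vectors in $\{0,1\}^k$ such that for every tuple $(x_1,\dots,x_k)$ the vectors $(\chi_A(x_1),\dots,\chi_A(x_k))$ and $f(x_1,\dots,x_k)$ agree in at least one position. *)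

(* Defs.v *)
From mathcomp Require Import all_boot.
Set Implicit Arguments.
Unset Strict Implicit.
Unset Printing Implicit Defensive.

(* Partial functions are represented by their graphs, [F v y] meaning that   *)
(* [F v] is defined with value [y]; [F v] diverges when no such [y] exists.   *)

(* Kleene's mu-recursive terms, indexed by their arity.                       *)
Inductive recf : nat -> Type :=
| Zero n : recf n
| Succ : recf 1
| Proj n (i : 'I_n) : recf n
| Comp m n (f : recf m) (g : 'I_m -> recf n) : recf n
| Prec n (f : recf n) (g : recf n.+2) : recf n.+1
| Mu n (f : recf n.+1) : recf n.

Arguments Zero {n}.

(* h(0, v) = F(v) and h(t + 1, v) = G(t, h(t, v), v).                         *)
Fixpoint prec_graph n (F : n.-tuple nat -> nat -> Prop)
    (G : n.+2.-tuple nat -> nat -> Prop) (v : n.-tuple nat) (t y : nat) : Prop :=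
  if t is t'.+1 then
    exists2 z, prec_graph F G v t' z & G [tuple of t' :: z :: v] y
  else F v y.

(* Composition is strict, and a search [Mu f] diverges as soon as [f] is      *)
(* undefined before its first zero.                                           *)
Fixpoint eval n (c : recf n) : n.-tuple nat -> nat -> Prop :=
  match c in recf n return n.-tuple nat -> nat -> Prop with
  | Zero _ => fun v y => y = 0
  | Succ => fun v y => y = (thead v).+1
  | Proj _ i => fun v y => y = tnth v i
  | Comp m _ f g => fun v y =>
      exists2 w : m.-tuple nat, forall i, eval (g i) v (tnth w i) & eval f w y
  | Prec _ f g => fun v y =>
      prec_graph (eval f) (eval g) [tuple of behead v] (thead v) y
  | Mu _ f => fun v y =>
      eval f [tuple of y :: v] 0 /\
      forall t, t < y -> exists z, eval f [tuple of t :: v] z.+1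
  end.

Lemma eval_functional n (c : recf n) v y1 y2 :
  eval c v y1 -> eval c v y2 -> y1 = y2.
Proof.
elim: c v y1 y2 => {n} [n|| n i | m n f IHf g IHg | n f IHf g IHg | n f IHf]
    v y1 y2 /=.
- by move=> -> ->.
- by move=> -> ->.
- by move=> -> ->.
- case=> w1 g1 f1 [w2 g2 f2]; apply: IHf f1 _.
  suff -> : w1 = w2 by [].
  by apply: eq_from_tnth => i; apply: IHg (g1 i) (g2 i).
- elim: (thead v) y1 y2 => [|t IHt] y1 y2 /=; first exact: IHf.
  case=> z1 h1 e1 [z2 h2 e2]; move: e2; rewrite -(IHt _ _ h1 h2).
  exact: IHg e1.
case=> e1 lt1 [e2 lt2]; case: (ltngtP y1 y2) => // lty.
- by have [z /IHf/(_ e1)] := lt2 _ lty.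
- by have [z /IHf/(_ e2)] := lt1 _ lty.
Qed.

Definition partial_recursive n (F : n.-tuple nat -> nat -> Prop) : Prop :=
  exists c : recf n, forall v y, F v y <-> eval c v y.

Definition computable n (f : n.-tuple nat -> nat) : Prop :=
  partial_recursive (fun v y => y = f v).

(* [phi e x y] means that phi_e(x) = U(e, x) is defined and equal to [y].     *)
Record numbering : Type := Numbering {
  numbering_graph :> nat -> nat -> nat -> Prop;
  numberingP : partial_recursive (fun (v : 2.-tuple nat) y =>
    numbering_graph (tnth v ord0) (tnth v ord_max) y)
}.

(* Equality of partial functions, including equality of their domains.        *)
Definition same_pfun (F G : nat -> nat -> Prop) : Prop :=
  forall x y, F x y <-> G x y.

Definition Kolmogorov_property (phi : numbering) : Prop :=
  forall psi : numbering, exists2 c : nat, 0 < c &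
    exists f : nat -> nat,
      forall e, f e <= c * e + c /\ same_pfun (phi (f e)) (psi e).

Definition MIN (phi : numbering) (e : nat) : Prop :=
  forall j, j < e -> ~ same_pfun (phi j) (phi e).

(* A vector-valued function is computable when each of its components is,     *)
(* labels being read as the numbers 0 and 1.                                  *)
Definition one_out_of_recursive (k : nat) (A : nat -> Prop) : Prop :=
  exists2 f : k.-tuple nat -> k.-tuple bool,
    forall i : 'I_k, computable (fun x => nat_of_bool (tnth (f x) i)) &
    forall x : k.-tuple nat, exists i : 'I_k,
      A (tnth x i) <-> tnth (f x) i = true.

(* Main.v *)
Require Import Defs.
From mathcomp Require Import all_boot.
From mathcomp Require Import zify.
From Stdlib Require Import ClassicalEpsilon.
Set Implicit Arguments.
Unset Strict Implicit.
Unset Printing Implicit Defensive.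

(* Applied to the numbering of the constant functions, the Kolmogorov         *)
(* property gives a c > 0 such that MIN has about M / c elements below every  *)
(* M. Suppose that MIN is (1,k)-recursive via f. The subsets of [0, M) that   *)
(* agree with f somewhere on every k-tuple shatter no k-tuple, so there are   *)
(* at most (M + 1)^k of them (Sauer-Shelah). With M = N^4 and N large, a      *)
(* greedy choice therefore gives N points of [N^3, N^4) meeting each of these *)
(* sets that fills a fraction 1 / 2c of [0, N^4); one of the points is in     *)
(* MIN. Such points y_0, ..., y_{N-1} can be found by search from N. Let      *)
(* psi_{N^2 + i} = phi_{y_i}. Then some minimal y_i >= N^3 has a phi-index    *)
(* that is O(N^2), a contradiction.                                           *)

(** The minimal indices of the constant functions are distinct and linearly bounded, so [MIN phi] is
    dense ([MIN_density]); yet a large minimal index cannot have a short description. Agreement with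
    [f] leaves polynomially many candidates for [MIN phi] below [N ^ 4] ([sauer_shelah]), while each
    greedy point cuts the dense candidates not yet hit by a constant factor ([greedy_hitting]), so
    [N] points suffice ([agreeing_sets_hit]). Whether a list hits all candidates is a bounded test,
    so the points are computable from [N] ([computable_hitting]). The code [N ^ 2 + i] of the [i]-th
    point is then too short for a minimal index of at least [N ^ 3]. *)

(** * Computable functions *)

(* [s] is the list of the [n] arguments. It also serves as a de Bruijn        *)
(* environment: under a binder, [head 0 s] is the bound variable and          *)
(* [behead s] the environment outside.                                        *)
Definition rc n (f : seq nat -> nat) : Prop :=
  computable (fun v : n.-tuple nat => f v).

Notation rcb n P := (rc n (fun s => nat_of_bool (P s))).

Lemma eq_rc n f g : f =1 g -> rc n f -> rc n g.
Proof. by move=> fg [c cP]; exists c => v y; rewrite -fg. Qed.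

(** Composition in general form: the entries of [h s] are the values of the inner functions. *)
Lemma rc_subst m n f (h : seq nat -> seq nat) :
  rc m f -> (forall s, size s = n -> size (h s) = m) ->
  (forall i, i < m -> rc n (fun s => nth 0 (h s) i)) ->
  rc n (fun s => f (h s)).
Proof.
move=> [c cP] hm hR.
have /fin_all_exists [d dP] (i : 'I_m) := hR i (ltn_ord i).
exists (Comp c d) => v y /=.
pose w : m.-tuple nat := Tuple (introT eqP (hm v (size_tuple v))).
have wE i : tnth w i = nth 0 (h v) i by rewrite (tnth_nth 0).
split=> [-> | [w' /(_ _)/dP w'P /cP ->]].
  by exists w => [i|]; [exact/dP | exact/cP].
congr f; rewrite -[RHS]/(tval w); congr tval.
by apply: eq_from_tnth => i; rewrite w'P.
Qed.

Lemma rc_nth n i : i < n -> rc n (fun s => nth 0 s i).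
Proof.
by move=> lt_in; exists (Proj (Ordinal lt_in)) => v y; rewrite /= (tnth_nth 0).
Qed.

Lemma rc_head n : rc n.+1 (fun s => head 0 s).
Proof. by apply: eq_rc (rc_nth (ltn0Sn n)) => s; rewrite nth0. Qed.

Lemma rc_behead n f : rc n f -> rc n.+1 (fun s => f (behead s)).
Proof.
move=> fR; apply: rc_subst fR _ _ => [s|i lt_in].
  by rewrite size_behead => ->.
apply: eq_rc (rc_nth (_ : i.+1 < n.+1)) => // s.
by rewrite nth_behead.
Qed.

Lemma rc_behead2 n f : rc n f -> rc n.+2 (fun s => f (behead (behead s))).
Proof. by move=> fR; apply: rc_behead (rc_behead fR). Qed.

Lemma rc_head_behead n : rc n.+2 (fun s => head 0 (behead s)).
Proof. exact: rc_behead (rc_head n). Qed.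

Lemma rc_let n a f : rc n a -> rc n.+1 f -> rc n (fun s => f (a s :: s)).
Proof.
move=> aR /rc_subst; apply=> [s /= -> // | [|i] lt_in]; first exact: aR.
exact: (rc_nth (i := i)) lt_in.
Qed.

Lemma rc_succ n a : rc n a -> rc n (fun s => (a s).+1).
Proof.
move=> aR.
have sR : rc 1 (fun s => (head 0 s).+1).
  by exists Succ => v y; case/tupleP: v => x v; rewrite /= theadE.
by apply: (rc_subst (h := fun s => [:: a s])) sR _ _ => // -[].
Qed.

Lemma rc_const n m : rc n (fun=> m).
Proof.
by elim: m => [|m IHm]; [exists (Zero) | apply: rc_succ IHm].
Qed.

(** In the environment of the step function, the counter comes first and the accumulated value
    second. *)
Lemma rc_rec n a b g :
  rc n a -> rc n b ->
  rc n.+2 (fun s => g (head 0 s) (head 0 (behead s)) (behead (behead s))) ->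
  rc n (fun s => nat_rec _ (b s) (fun t z => g t z s) (a s)).
Proof.
move=> aR [cb bP] [cg gP].
pose r s := nat_rec (fun=> nat) (b (behead s))
  (fun t z => g t z (behead s)) (head 0 s).
suff rR : rc n.+1 r by apply: rc_let aR rR.
exists (Prec cb cg) => v y; case/tupleP: v => t v; rewrite /r /= theadE.
have -> : [tuple of behead [tuple of t :: v]] = v by apply: val_inj.
elim: t y => [|t IHt] y; first exact: bP.
split=> [-> | [z /IHt -> /gP //]].
by exists (nat_rec _ (b v) (fun t z => g t z v) t); [exact/IHt | exact/gP].
Qed.

Lemma rc_add n a b : rc n a -> rc n b -> rc n (fun s => a s + b s).
Proof.
move=> aR bR; apply: eq_rc (rc_rec aR bR (g := fun _ z _ => z.+1) _) => [s|].
  by elim: (a s) => //= m ->.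
exact/rc_succ/rc_head_behead.
Qed.

Lemma rc_pred n a : rc n a -> rc n (fun s => (a s).-1).
Proof.
move=> aR.
apply: eq_rc (rc_rec aR (rc_const _ 0) (g := fun t _ _ => t) (rc_head _)) => s.
by case: (a s).
Qed.

Lemma rc_sub n a b : rc n a -> rc n b -> rc n (fun s => a s - b s).
Proof.
move=> aR bR; apply: eq_rc (rc_rec bR aR (g := fun _ z _ => z.-1) _) => [s|].
  by elim: (b s) => [|m] /=; [rewrite subn0 | rewrite subnS => ->].
exact/rc_pred/rc_head_behead.
Qed.

Lemma rc_mul n a b : rc n a -> rc n b -> rc n (fun s => a s * b s).
Proof.
move=> aR bR.
apply: eq_rc (rc_rec aR (rc_const _ 0) (g := fun _ z s => b s + z) _) => [s|].
  by elim: (a s) => //= m ->.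
apply: rc_add; first exact: rc_behead2.
exact: rc_head_behead.
Qed.

Lemma rc_exp n a b : rc n a -> rc n b -> rc n (fun s => a s ^ b s).
Proof.
move=> aR bR.
apply: eq_rc (rc_rec bR (rc_const _ 1) (g := fun _ z s => a s * z) _) => [s|].
  by elim: (b s) => //= m ->; rewrite expnS.
apply: rc_mul; first exact: rc_behead2.
exact: rc_head_behead.
Qed.

Lemma rcb_leq n a b : rc n a -> rc n b -> rcb n (fun s => a s <= b s).
Proof.
move=> aR bR; apply: eq_rc (rc_sub (rc_const n 1) (rc_sub aR bR)) => s.
by rewrite /leq; case: (a s - b s).
Qed.

Lemma rcb_not n P : rcb n P -> rcb n (fun s => ~~ P s).
Proof.
by move=> PR; apply: eq_rc (rc_sub (rc_const n 1) PR) => s; case: (P s).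
Qed.

(** A witness for every [s] makes the search total. [Mu] looks for a zero, so it is applied to the
    negation of [P]. *)
Lemma rc_mu n P :
  rcb n.+1 (fun s => P (head 0 s) (behead s)) ->
  (forall s, exists y, P y s) ->
  exists2 g, rc n g & forall s, P (g s) s.
Proof.
move=> PR exP.
case: (rcb_not PR) => c cP.
exists (fun s => ex_minn (exP s)) => [|s]; last by case: ex_minnP.
exists (Mu c) => v y; case: ex_minnP => m Pm minm /=.
have cE t z : eval c [tuple of t :: v] z <-> z = ~~ P t v by rewrite -cP.
split=> [->|[/cE Py lty]].
  split=> [|t ltt]; first by apply/cE; rewrite Pm.
  exists 0; apply/cE; case Pt: (P t v) => //.
  by move: (minm t Pt); rewrite leqNgt ltt.
have {}Py : P y v by move: Py; case: (P y v).
apply/eqP; rewrite eqn_leq (minm _ Py) andbT leqNgt; apply/negP => ltm.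
by have [z /cE] := lty _ ltm; rewrite Pm.
Qed.

Lemma rcb_and n P Q : rcb n P -> rcb n Q -> rcb n (fun s => P s && Q s).
Proof.
by move=> PR QR; apply: eq_rc (rc_mul PR QR) => s; case: (P s); case: (Q s).
Qed.

Lemma rcb_or n P Q : rcb n P -> rcb n Q -> rcb n (fun s => P s || Q s).
Proof.
move=> PR QR; apply: eq_rc (rcb_not (rcb_and (rcb_not PR) (rcb_not QR))) => s.
by rewrite negb_and !negbK.
Qed.

Lemma rcb_eq n a b : rc n a -> rc n b -> rcb n (fun s => a s == b s).
Proof.
move=> aR bR; apply: eq_rc (rcb_and (rcb_leq aR bR) (rcb_leq bR aR)) => s.
by rewrite eqn_leq.
Qed.

Lemma rcb_eqb n P Q : rcb n P -> rcb n Q -> rcb n (fun s => P s == Q s).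
Proof.
by move=> PR QR; apply: eq_rc (rcb_eq PR QR) => s; case: (P s); case: (Q s).
Qed.

Lemma rc_if n P a b :
  rcb n P -> rc n a -> rc n b -> rc n (fun s => if P s then a s else b s).
Proof.
move=> PR aR bR.
apply: eq_rc (rc_add (rc_mul PR aR) (rc_mul (rcb_not PR) bR)) => s.
by case: (P s); rewrite /= ?mul1n ?mul0n ?addn0.
Qed.

Lemma rc_count n a P :
  rc n a -> rcb n.+1 (fun s => P (head 0 s) (behead s)) ->
  rc n (fun s => count (fun x => P x s) (iota 0 (a s))).
Proof.
move=> aR PR.
apply: eq_rc (rc_rec aR (rc_const _ 0) (g := fun t z s => P t s + z) _) => [s|].
  elim: (a s) => [//|m IHm]; rewrite -[in RHS]addn1 iotaD count_cat add0n /=.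
  by rewrite addn0 -IHm addnC.
apply: rc_add; last exact: rc_head_behead.
(* The recursion step binds a counter and an accumulator, [P] only the counter; [h] deletes the
   accumulator. *)
pose h s := head 0 s :: behead (behead s).
apply: (rc_subst (h := h)) PR _ _ => [[|x [|y s]] //= [->] // | [_|i lt_in]].
  exact: rc_head.
apply: eq_rc (rc_nth (_ : i.+2 < n.+2)) => // s.
by rewrite /h /= !nth_behead.
Qed.

Lemma rcb_has n a P :
  rc n a -> rcb n.+1 (fun s => P (head 0 s) (behead s)) ->
  rcb n (fun s => has (fun x => P x s) (iota 0 (a s))).
Proof.
move=> aR PR; apply: eq_rc (rcb_leq (rc_const _ 1) (rc_count aR PR)) => s.
by rewrite has_count.
Qed.

Lemma rcb_all n a P :
  rc n a -> rcb n.+1 (fun s => P (head 0 s) (behead s)) ->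
  rcb n (fun s => all (fun x => P x s) (iota 0 (a s))).
Proof.
move=> aR PR.
have hR := rcb_has aR (P := fun x s => ~~ P x s) (rcb_not PR).
apply: eq_rc (rcb_not hR) => s.
by rewrite -all_predC; congr nat_of_bool; apply: eq_all => x /=; rewrite negbK.
Qed.

Lemma rcb_exists n k (P : 'I_k -> seq nat -> bool) :
  (forall i, rcb n (P i)) -> rcb n (fun s => [exists i, P i s]).
Proof.
move=> PR.
have hR : rcb n (fun s => has (fun i => P i s) (enum 'I_k)).
  elim: (enum 'I_k) => [|i r IHr] /=; first exact: rc_const.
  exact: rcb_or.
apply: eq_rc hR => s; congr nat_of_bool.
by apply/hasP/existsP => [[i _ Pi]|[i Pi]]; exists i; rewrite ?mem_enum.
Qed.

Lemma rc_mod n a b : rc n a -> rc n b -> rc n (fun s => a s %% b s).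
Proof.
move=> aR bR.
(* The remainder counts up and resets at [b s]. If [b s = 0] it never resets, in accordance with
   [m %% 0 = m]. *)
pose g (t z : nat) s := if z.+1 == b s then 0 else z.+1.
apply: eq_rc (rc_rec aR (rc_const _ 0) (g := g) _) => [s|].
  elim: (a s) => [|m /= ->]; first by rewrite mod0n.
  rewrite modnS /g; case: (posnP (b s)) => [->|b_gt0].
    by rewrite modn0.
  congr (if _ then _ else _); rewrite /dvdn -[m.+1]addn1 -modnDml addn1.
  have := ltn_pmod m b_gt0; rewrite leq_eqVlt => /orP[/eqP e | lt].
    by rewrite e modnn !eqxx.
  by rewrite (modn_small lt) (ltn_eqF lt).
have zR : rc n.+2 (fun s => head 0 (behead s)) by exact: rc_head_behead.
apply: rc_if; [apply: rcb_eq | exact: rc_const | exact: rc_succ].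
  exact: rc_succ.
exact: rc_behead2.
Qed.

Lemma rc_div n a b : rc n a -> rc n b -> rc n (fun s => a s %/ b s).
Proof.
move=> aR bR.
(* The quotient grows at each positive multiple of [b s]; it stays 0 if [b s = 0]. *)
pose g (t z : nat) s := (t.+1 %% b s == 0) + z.
apply: eq_rc (rc_rec aR (rc_const _ 0) (g := g) _) => [s|].
  elim: (a s) => [|m /= ->]; first by rewrite div0n.
  rewrite /g; case: (posnP (b s)) => [->|b_gt0]; first by rewrite modn0.
  by rewrite divnS.
apply: rc_add; last exact: rc_head_behead.
apply: rcb_eq (rc_const _ 0); apply: rc_mod; first exact/rc_succ/rc_head.
exact: rc_behead2.
Qed.

(** * Digits and integer square roots *)

Definition digit b w i := w %/ b ^ i %% b.

Lemma ltn_digit b w i : 0 < b -> digit b w i < b.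
Proof. exact: ltn_pmod. Qed.

(** Sequences are coded by digits, least significant first; the bound on the code turns quantifiers
    over sequences into bounded ones. *)
Lemma digitsP b u : all (gtn b) u ->
  exists2 w, w < b ^ size u & forall i, i < size u -> digit b w i = nth 0 u i.
Proof.
elim: u => [|x u IHu] /=; first by exists 0.
case/andP=> lt_xb /IHu [w lt_w wP]; exists (x + b * w) => [|[|i] lt_i].
- have := leq_mul (leqnn b) lt_w; rewrite expnS; lia.
- by rewrite /digit divn1 addnC mulnC modnMDl modn_small.
have b_gt0 : 0 < b by apply: leq_ltn_trans lt_xb.
rewrite /= -wP // /digit expnS divnMA addnC mulnC divnMDl //.
by rewrite (divn_small lt_xb) addn0.
Qed.

Definition isqrt n := count (fun t => t.+1 ^ 2 <= n) (iota 0 n).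

(** This decodes the pair [(N, i)], [i < N], from [N ^ 2 + i], a code of quadratic size and hence
    far below [N ^ 3]. *)
Lemma isqrtE N i : i <= N.*2 -> isqrt (N ^ 2 + i) = N.
Proof.
move=> le_i; have le_N : N <= N ^ 2 + i by nia.
rewrite /isqrt (@eq_count _ _ (gtn N)) => [|t /=]; last by apply/idP/idP; nia.
rewrite -{1}(subnKC le_N) iotaD count_cat.
rewrite -[RHS]addn0 -[X in _ = X + _](size_iota 0 N); congr (_ + _).
  by apply/eqP; rewrite -all_count; apply/allP => t; rewrite mem_iota.
apply/eqP; rewrite -leqn0 leqNgt -has_count.
by apply/hasPn => t; rewrite mem_iota /=; lia.
Qed.

(** * Hitting sets *)

(** Induction on the length, splitting by the first bit: the size of [F] is that of the set [G] of
    tails plus that of the set [H] of tails extending both ways. [G] shatters no [k.+1] positions,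
    and [H] no [k] positions, because position 0 could be added to them. The two bounds add up to
    [N.+2 * N.+1 ^ k]. *)
Lemma sauer_shelah k N (F : seq (seq bool)) :
    uniq F -> {in F, forall s, size s = N} ->
    (forall xs, size xs = k -> all (gtn N) xs ->
       exists2 p, size p = k & {in F, forall s, map (nth false s) xs != p}) ->
  size F <= N.+1 ^ k.
Proof.
elim: N k F => [|N IHN] k F uF sF shF.
  rewrite exp1n; case: F uF sF {shF} => [|s [|s' F]] //= uF sF.
  have /size0nil es := sF s (mem_head _ _).
  have /size0nil es' : size s' = 0 by apply: sF; rewrite !inE eqxx orbT.
  by rewrite es es' inE eqxx in uF.
case: k shF => [|k] shF.
  (* The empty pattern is realised by every string, so [F] is empty. *)
  have [[|//] _ noF] := shF [::] erefl erefl.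
  by case: F noF {uF sF shF} => // s F /(_ s (mem_head _ _)).
pose G := undup (map behead F).
pose P b s := (b :: s : seq bool) \in F.
have countP b : count (fun s => head true s == b) F = count (P b) G.
  rewrite -2!size_filter -(size_map behead); apply/perm_size/uniq_perm.
  - rewrite map_inj_in_uniq ?filter_uniq // => s s'.
    rewrite !mem_filter => /andP[hs /sF]; case: s hs => //= x s /eqP-> _.
    by case/andP=> hs' /sF; case: s' hs' => //= x' s' /eqP-> _ ->.
  - by rewrite filter_uniq ?undup_uniq.
  move=> s; rewrite mem_filter mem_undup; apply/mapP/andP.
    case=> s'; rewrite mem_filter => /andP[hs' s'F ->]; split; last exact: map_f.
    by rewrite /P; have := sF _ s'F; case: s' hs' s'F => //= x s' /eqP->.
  by case=> sP _; exists (b :: s); rewrite ?mem_filter //= eqxx.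
have sizeF : size F = count (P true) G + count (P false) G.
  rewrite -!countP -(count_predC (fun s => head true s == true) F).
  by congr (_ + _); apply: eq_count => s /=; case: (head true s).
have G_F s : s \in G -> exists b, b :: s \in F.
  rewrite mem_undup => /mapP[[|b s'] s'F ->]; last by exists b.
  by have := sF _ s'F.
have sG : {in G, forall s, size s = N}.
  by move=> s /G_F [b /sF []].
have leG : size G <= N.+1 ^ k.+1.
  apply: IHN => // [|xs sxs ltxs]; first exact: undup_uniq.
  have [||p sp pP] := shF (map S xs).
  - by rewrite size_map.
  - by rewrite all_map.
  exists p => // s /G_F [b /pP]; rewrite -map_comp; apply: contra => /eqP <-.
  by apply/eqP/eq_map.
pose H := [seq s <- G | P true s & P false s].
have leH : size H <= N.+1 ^ k.
  apply: IHN => [|s|xs sxs ltxs]; first by rewrite filter_uniq ?undup_uniq.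
    by rewrite mem_filter => /andP[_ /sG].
  have [||p sp pP] := shF (0 :: map S xs).
  - by rewrite /= size_map sxs.
  - by rewrite /= all_map.
  case: p sp pP => // b p [sp] pP; exists p => // s; rewrite mem_filter.
  case/andP=> /andP[Pt Pf] _; have /pP : b :: s \in F by case: (b).
  apply: contra => /eqP <- /=; apply/eqP; congr (_ :: _).
  by rewrite -map_comp; apply: eq_map.
rewrite sizeF -count_predUI -[X in _ + X]size_filter.
apply: leq_trans (leq_add (leq_trans (count_size _ _) leG) leH) _.
rewrite [N.+1 ^ _]expnS -[X in _ + X]mul1n -mulnDl addn1 [X in _ <= X]expnS.
by rewrite leq_mul2l; case: (k) => [|k'] //; rewrite leq_exp2r ?leqnSn ?orbT.
Qed.

Lemma count_nat_sum (T : Type) (P : pred T) s :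
  count P s = \sum_(x <- s) P x.
Proof. by rewrite -sum1_count big_mkcond; apply: eq_bigr => x _; case: (P x). Qed.

Lemma sum_nat_const_seq (T : Type) (s : seq T) n : \sum_(x <- s) n = size s * n.
Proof. by rewrite big_const_seq count_predT iter_addn_0 mulnC. Qed.

(** By averaging, some point of [V] hits at least a fraction [1 / a.+1] of the sets not yet hit;
    adding it leaves at most [a / a.+1] of them. *)
Lemma greedy_hitting (T U : eqType) (hit : U -> pred T) (V : seq T) (F : seq U)
    a r :
    V != [::] -> {in F, forall S, size V <= a.+1 * count (hit S) V} ->
  exists L, [/\ size L = r, {subset L <= V} &
    count (fun S => ~~ has (hit S) L) F * a.+1 ^ r <= size F * a ^ r].
Proof.
move=> V_neq0 largeF; elim: r => [|r [L [sL LV leL]]].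
  by exists [::]; split=> //; rewrite !muln1 count_size.
pose G := [seq S <- F | ~~ has (hit S) L].
(* Otherwise counting the pairs of a set in [G] and a point of [V] hitting it in two ways
   contradicts [largeF]; strictness comes from [V] being nonempty. *)
have [y yV hy] : exists2 y, y \in V & size G <= a.+1 * count (hit^~ y) G.
  apply/hasP; rewrite -[has _ _]negbK -all_predC; apply/negP => /allP small.
  have : \sum_(S <- G) size V <= a.+1 * \sum_(S <- G) count (hit S) V.
    rewrite big_distrr /= big_seq [leqRHS]big_seq; apply: leq_sum => S.
    by rewrite mem_filter => /andP[_ /largeF].
  have -> : \sum_(S <- G) count (hit S) V = \sum_(y <- V) count (hit^~ y) G.
    under eq_bigr do rewrite count_nat_sum; rewrite exchange_big /=.
    by apply: eq_bigr => y _; rewrite count_nat_sum.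
  apply/negP; rewrite -ltnNge sum_nat_const_seq big_distrr /=.
  have : \sum_(y <- V) (a.+1 * count (hit^~ y) G).+1 <= \sum_(y <- V) size G.
    by rewrite big_seq [leqRHS]big_seq; apply: leq_sum => y /small;
      rewrite /= -ltnNge.
  rewrite sum_nat_const_seq.
  under eq_bigr do rewrite -addn1; rewrite big_split /= sum_nat_const_seq.
  by case: (V) V_neq0 => //= *; lia.
exists (y :: L); split=> [|z|]; first by rewrite /= sL.
  by rewrite inE => /predU1P[->|/LV].
have -> : count (fun S => ~~ has (hit S) (y :: L)) F = size G - count (hit^~ y) G.
  rewrite -(count_predC (hit^~ y) G) addKn count_filter.
  by apply: eq_count => S /=; rewrite negb_or.
rewrite size_filter in hy *.
rewrite !expnS [X in _ <= X]mulnCA mulnA.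
apply: leq_trans (_ : a * (count (fun S => ~~ has (hit S) L) F * a.+1 ^ r) <= _).
  by rewrite mulnA leq_mul2r; apply/orP; right; nia.
by rewrite leq_mul2l leL orbT.
Qed.

(** Raise [N < t * p.+1 * 2 ^ (N %/ (t * p.+1))] to the power [p.+1]: compared with the power [p],
    this leaves a spare factor [N] that absorbs the constant [K]. *)
Lemma expn_lt_exp2n t p : 0 < t ->
  exists N0, forall N, N0 <= N -> N ^ p < 2 ^ (N %/ t).
Proof.
move=> t_gt0; pose K := (t * p.+1) ^ p.+1; exists K.+1 => N ltKN.
have tp_gt0 : 0 < t * p.+1 by rewrite muln_gt0 t_gt0.
have N_gt0 : 0 < N by apply: leq_ltn_trans ltKN.
rewrite -(ltn_pmul2l N_gt0) -expnS.
apply: leq_ltn_trans (_ : K * 2 ^ (N %/ t) < _); last first.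
  by rewrite ltn_pmul2r ?expn_gt0.
apply: leq_trans (_ : (t * p.+1 * 2 ^ (N %/ (t * p.+1))) ^ p.+1 <= _).
  rewrite leq_exp2r // ltnW //; apply: leq_trans (ltn_ceil N tp_gt0) _.
  by rewrite mulnC leq_mul2l ltn_expl ?orbT.
by rewrite expnMn -expnM leq_mul2l divnMA leq_exp2l // leq_trunc_div orbT.
Qed.

(** The left side consists of the first two terms of the binomial expansion. *)
Lemma expn_succ_lower a n : a ^ n.+1 + n.+1 * a ^ n <= a.+1 ^ n.+1.
Proof.
elim: n => [|n IHn]; first by rewrite !expn1 expn0; lia.
rewrite [a.+1 ^ _]expnS; apply: leq_trans (leq_mul (leqnn _) IHn).
rewrite !expnS; nia.
Qed.

(** Each block of [a.+1] factors gains a factor 2 when [a] is replaced by [a.+1]. *)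
Lemma double_expn_succ a N : 2 ^ (N %/ a.+1) * a ^ N <= a.+1 ^ N.
Proof.
have two : 2 * a ^ a.+1 <= a.+1 ^ a.+1.
  by apply: leq_trans (expn_succ_lower a a); rewrite expnS; lia.
rewrite {2 3}(divn_eq N a.+1) !expnD mulnA; apply: leq_mul; last first.
  by case: (N %% a.+1) => [|m] //; rewrite leq_exp2r.
rewrite mulnC [_ %/ _ * _]mulnC !expnM -expnMn mulnC.
by case: (N %/ a.+1) => [|m] //; rewrite leq_exp2r.
Qed.

Definition decide (P : Prop) : bool :=
  if excluded_middle_informative P then true else false.

Lemma decideP P : reflect P (decide P).
Proof. by rewrite /decide; case: excluded_middle_informative => ?; constructor. Qed.

Definition agree k (f : k.-tuple nat -> k.-tuple bool) (S : pred nat) x :=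
  [exists i, S (tnth x i) == tnth (f x) i].

Lemma eq_agree k f S S' (x : k.-tuple nat) :
  {in x, S =1 S'} -> agree f S x = agree f S' x.
Proof. by move=> eqS; apply: eq_existsb => i; rewrite eqS ?mem_tnth. Qed.

(** A set agreeing with [f] somewhere on [x] cannot realise the complement of [f x] there, so the
    candidates shatter no [k]-tuple. After [N] greedy points fewer than
    [N ^ (5 * k) * (a / a.+1) ^ N < 1] dense candidates remain unhit, that is, none. *)
Lemma agreeing_sets_hit k (f : k.-tuple nat -> k.-tuple bool) a :
  exists N0, forall N, N0 <= N -> exists L : seq nat,
    [/\ size L = N, all (fun y => N ^ 3 <= y < N ^ 4) L &
      forall S : pred nat,
        (forall x : k.-tuple nat, all (gtn (N ^ 4)) x -> agree f S x) ->
        N ^ 4 <= a.+1 * count (fun y => (N ^ 3 <= y) && S y) (iota 0 (N ^ 4)) ->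
      has S L].
Proof.
(* The exponent comes from [(N ^ 4).+1 <= N ^ 5], valid for [N >= 2]. *)
have [N0 N0P] := expn_lt_exp2n (5 * k) (ltn0Sn a).
exists (maxn 2 N0) => N; rewrite geq_max => /andP[N_gt1 /N0P ltN].
set M := N ^ 4.
pose agrees s := decide (forall x : k.-tuple nat,
  all (gtn M) x -> agree f (nth false s) x).
pose V := [seq y <- iota 0 M | N ^ 3 <= y].
pose F := [seq s <- [seq val t | t <- enum {: M.-tuple bool}] |
  agrees s && (size V <= a.+1 * count (nth false s) V)].
have sizeF : size F <= M.+1 ^ k.
  apply: sauer_shelah => [|s|xs sxs ltxs].
  - by rewrite filter_uniq // map_inj_uniq ?enum_uniq //; apply: val_inj.
  - by rewrite mem_filter => /andP[_ /mapP[u _ ->]]; apply: size_tuple.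
  pose x : k.-tuple nat := Tuple (introT eqP sxs).
  exists (map negb (f x)); first by rewrite size_map size_tuple.
  move=> s; rewrite mem_filter => /andP[/andP[/decideP/(_ x ltxs)/existsP[i]]].
  move=> /eqP agi _ _; apply/eqP => eqm.
  have := congr1 (nth false ^~ i) eqm.
  rewrite (nth_map 0) ?sxs // (nth_map false) ?size_tuple //.
  by rewrite -[xs]/(tval x) -!tnth_nth agi; case: (tnth _ _).
have V_neq0 : V != [::].
  have : N ^ 3 \in V by rewrite mem_filter leqnn mem_iota /= add0n ltn_exp2l.
  by apply: contraTneq => ->.
have [|L [sL LV leL]] :=
    greedy_hitting (hit := fun s => nth false s) (F := F) (a := a) N V_neq0.
  by move=> s; rewrite mem_filter => /andP[/andP[]].
have unhit0 : count (fun s => ~~ has (nth false s) L) F = 0.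
  apply/eqP; rewrite -leqn0 leqNgt; apply/negP => unhit_gt0.
  suff : size F * a ^ N < a.+1 ^ N.
    by rewrite ltnNge => /negP; apply; apply: leq_trans leL; apply: leq_pmull.
  case: (posnP (a ^ N)) => [->|aN_gt0]; first by rewrite muln0 expn_gt0.
  apply: leq_trans (double_expn_succ a N); rewrite ltn_pmul2r //.
  apply: leq_ltn_trans ltN; apply: leq_trans sizeF _.
  rewrite expnM; case: (k) => [|k'] //; rewrite leq_exp2r // /M.
  by rewrite (expnS N 4); apply: leq_trans (leq_mul N_gt1 (leqnn _)); nia.
exists L; split=> // [|S agS largeS].
  by apply/allP => y /LV; rewrite mem_filter mem_iota.
pose s := mkseq S M.
have sE : {in V, nth false s =1 S}.
  move=> y; rewrite mem_filter mem_iota add0n => /andP[_ /andP[_ ltyM]].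
  by rewrite nth_mkseq.
have sF : s \in F.
  rewrite mem_filter; apply/andP; split; last first.
    by apply/mapP; exists (mktuple (fun i : 'I_M => S i)); rewrite ?mem_enum //=;
      rewrite /s /mkseq -val_enum_ord -map_comp.
  apply/andP; split.
    apply/decideP => x ltx; rewrite (@eq_agree _ _ _ S) ?agS // => y yx.
    by rewrite nth_mkseq //; apply: (allP ltx).
  rewrite (eq_in_count sE) count_filter.
  apply: leq_trans (_ : M <= _).
    by rewrite size_filter -[leqRHS](size_iota 0) count_size.
  rewrite (eq_count (a2 := fun y => (N ^ 3 <= y) && S y)) // => y /=.
  by rewrite andbC.
have : has (nth false s) L.
  apply/negPn/negP => nhas; have : 0 < count (fun s => ~~ has (nth false s) L) F.
    by rewrite -has_count; apply/hasP; exists s.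
  by rewrite unhit0.
by case/hasP=> y yL; rewrite sE ?LV // => Sy; apply/hasP; exists y.
Qed.

(** * Searching for a hitting set *)

Lemma rc_digit n b w i :
  rc n b -> rc n w -> rc n i -> rc n (fun s => digit (b s) (w s) (i s)).
Proof. by move=> bR wR iR; apply: rc_mod (rc_div wR (rc_exp bR iR)) bR. Qed.

Lemma rc_isqrt n a : rc n a -> rc n (fun s => isqrt (a s)).
Proof.
move=> aR; pose P t s := t.+1 ^ 2 <= a s.
apply: (rc_count (P := P) aR); apply: rcb_leq (rc_behead aR).
exact: rc_exp (rc_succ (rc_head n)) (rc_const _ 2).
Qed.

Definition bit w : pred nat := fun i => digit 2 w i == 1.

Lemma rcb_bit n w i : rc n w -> rc n i -> rcb n (fun s => bit (w s) (i s)).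
Proof.
by move=> wR iR; apply: rcb_eq (rc_digit (rc_const _ 2) wR iR) (rc_const _ 1).
Qed.

Lemma bitP S M : exists2 w, w < 2 ^ M & forall i, i < M -> bit w i = S i.
Proof.
have [|w] := @digitsP 2 (map (nat_of_bool \o S) (iota 0 M)).
  by apply/allP => _ /mapP[i _ ->] /=; case: (S i).
rewrite size_map size_iota => lt_w wP; exists w => // i ltiM.
rewrite /bit wP // (nth_map 0) ?size_iota // nth_iota //=.
by case: (S i).
Qed.

Section Search.
Variables (k : nat) (f : k.-tuple nat -> k.-tuple bool) (a : nat).
Hypothesis fR : forall i, computable (fun x => nat_of_bool (tnth (f x) i)).

(** With tuples decoded from numbers, quantifying over the tuples with entries below [b] becomes a
    search over [u < b ^ k]. *)
Definition code_agree b w u := agree f (bit w) (mktuple (fun i => digit b u i)).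

Lemma rcb_code_agree n b w u :
  rc n b -> rc n w -> rc n u -> rcb n (fun s => code_agree (b s) (w s) (u s)).
Proof.
move=> bR wR uR; apply: rcb_exists => i.
have dR j := rc_digit bR uR (rc_const n j).
apply: rcb_eqb.
  by apply: eq_rc (rcb_bit wR (dR i)) => s; rewrite tnth_mktuple.
have FR : rc k (fun s => tnth (f (mktuple (fun j => nth 0 s j))) i).
  have [c cP] := fR i; exists c => v y; rewrite -cP.
  suff -> : [tuple nth 0 v j | j < k] = v by [].
  by apply: eq_from_tnth => j; rewrite tnth_mktuple (tnth_nth 0).
pose h s := mkseq (digit (b s) (u s)) k.
apply: eq_rc (rc_subst (h := h) FR _ _) => [s|s _|j ltjk].
- congr (nat_of_bool (tnth (f _) i)); apply: eq_from_tnth => j.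
  by rewrite !tnth_mktuple nth_mkseq.
- by rewrite size_mkseq.
by apply: eq_rc (dR j) => s; rewrite nth_mkseq.
Qed.

Definition hits l w N i :=
  (N ^ 3 <= digit (N ^ 4) l i) && bit w (digit (N ^ 4) l i).

Definition small w N :=
  a.+1 * count (fun y => (N ^ 3 <= y) && bit w y) (iota 0 (N ^ 4)) < N ^ 4.

Definition disagrees w N :=
  has (fun u => ~~ code_agree (N ^ 4) w u) (iota 0 ((N ^ 4) ^ k)).

(* Sets are represented by the numbers [w < 2 ^ N ^ 4], and [l] is a list of  *)
(* [N] points, written in base [N ^ 4].                                       *)
Definition hits_all l N :=
  all (fun w => [|| disagrees w N, small w N | has (hits l w N) (iota 0 N)])
    (iota 0 (2 ^ (N ^ 4))).

Lemma rcb_hits_all n l N :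
  rc n l -> rc n N -> rcb n (fun s => hits_all (l s) (N s)).
Proof.
move=> lR NR.
have ER e := rc_exp NR (rc_const n e).
apply: (rcb_all (P := fun w s =>
  [|| disagrees w (N s), small w (N s)
    | has (hits (l s) w (N s)) (iota 0 (N s))])).
  exact: rc_exp (rc_const _ 2) (ER 4).
have E'R e := rc_behead (ER e); have E''R e := rc_behead2 (ER e).
have wR : rc n.+2 (fun s => head 0 (behead s)) := @rc_head_behead n.
apply: rcb_or; [|apply: rcb_or].
- apply: (rcb_has (P := fun u s =>
    ~~ code_agree (N (behead s) ^ 4) (head 0 s) u)).
    exact: rc_exp (E'R 4) (rc_const _ k).
  exact: rcb_not (rcb_code_agree (E''R 4) wR (rc_head _)).
- apply: rcb_leq (E'R 4); apply/rc_succ/(rc_mul (rc_const _ _)).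
  apply: (rc_count (P := fun y s =>
    (N (behead s) ^ 3 <= y) && bit (head 0 s) y)) (E'R 4) _.
  exact: rcb_and (rcb_leq (E''R 3) (rc_head _)) (rcb_bit wR (rc_head _)).
apply: (rcb_has (P := fun i s =>
  hits (l (behead s)) (head 0 s) (N (behead s)) i)).
  exact: rc_behead NR.
have dR := rc_digit (E''R 4) (rc_behead2 lR) (rc_head _).
exact: rcb_and (rcb_leq (E''R 3) dR) (rcb_bit wR dR).
Qed.

Lemma hits_all_exists :
  exists N0, forall N, N0 <= N -> exists l, hits_all l N.
Proof.
have [N0 N0P] := agreeing_sets_hit f a; exists N0 => N /N0P [L [sL LV LP]].
have [|l _ lP] := @digitsP (N ^ 4) L.
  by apply: sub_all LV => y /andP[].
exists l; apply/allP => w _; rewrite orbA.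
case: (boolP (disagrees w N || small w N)) => //=.
rewrite negb_or /small -leqNgt => /andP[agr large].
have /hasP[y yL wy] : has (bit w) L.
  apply: LP large => x ltx; move/hasPn: agr => agr.
  have [u ltu uP] := digitsP ltx; rewrite size_tuple in ltu uP.
  have /agr /negPn : u \in iota 0 ((N ^ 4) ^ k) by rewrite mem_iota.
  rewrite /code_agree; congr (agree _ _ _).
  by apply: eq_from_tnth => i; rewrite tnth_mktuple uP // (tnth_nth 0).
apply/hasP; exists (index y L); first by rewrite mem_iota -sL index_mem.
rewrite /hits lP ?index_mem // nth_index // wy andbT.
by have /andP[] := allP LV y yL.
Qed.

(** The code [w] of [S] below [N ^ 4] is among those tested, and [S] neither disagrees with [f] nor
    is small, so the list must hit it. *)
Lemma hits_allP l N (S : pred nat) :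
    0 < N -> hits_all l N -> (forall x, agree f S x) ->
    N ^ 4 <= a.+1 * count (fun y => (N ^ 3 <= y) && S y) (iota 0 (N ^ 4)) ->
  exists2 i, i < N & (N ^ 3 <= digit (N ^ 4) l i) && S (digit (N ^ 4) l i).
Proof.
move=> N_gt0 /allP hl agS large.
have M_gt0 : 0 < N ^ 4 by rewrite expn_gt0 N_gt0.
have [w ltw wP] := bitP S (N ^ 4).
have /hl /or3P[] : w \in iota 0 (2 ^ (N ^ 4)) by rewrite mem_iota.
- case/hasP=> u _; rewrite /code_agree (@eq_agree _ _ _ S) ?agS // => _ /tnthP[i ->].
  by rewrite tnth_mktuple wP ?ltn_digit.
- rewrite /small ltnNge => /negP[]; apply: leq_trans large _.
  pose Q y := (N ^ 3 <= y) && bit w y.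
  rewrite leq_mul2l (eq_in_count (a2 := Q)) ?leqnn ?orbT //.
  by move=> y; rewrite mem_iota /Q => /wP ->.
case/hasP=> i; rewrite mem_iota /hits => lti /andP[le3].
by rewrite wP ?ltn_digit // => Si; exists i => //; rewrite le3.
Qed.

(** The search consults only [f], never [MIN]; [h] reads [N] and [i] off its argument and returns
    the [i]-th point found for [N]. *)
Lemma computable_hitting : exists2 h, rc 1 h & exists N0, forall N,
  N0 <= N -> exists2 l, hits_all l N &
    forall i, i < N -> h [:: N ^ 2 + i] = digit (N ^ 4) l i.
Proof.
have [N0 N0P] := hits_all_exists.
(* The first disjunct lets the search succeed at once below [N0], where a hitting list is not
   guaranteed. *)
pose P l s := (head 0 s < N0) || hits_all l (head 0 s).
have [|s|g gR gP] := @rc_mu 1 P.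
- apply: rcb_or; last exact: rcb_hits_all (rc_head _) (rc_head_behead _).
  exact: rcb_leq (rc_succ (rc_head_behead _)) (rc_const _ _).
- case: (leqP N0 (head 0 s)) => [/N0P[l hl]|lt]; last by exists 0; rewrite /P lt.
  by exists l; rewrite /P hl orbT.
pose r s := isqrt (head 0 s).
have rR : rc 1 r := rc_isqrt (rc_head 0).
exists (fun s => digit (r s ^ 4) (g [:: r s]) (head 0 s - r s ^ 2)).
  apply: rc_digit (rc_exp rR (rc_const _ 4)) _ _.
    by apply: (rc_subst (h := fun s => [:: r s])) gR _ _ => // -[].
  exact: rc_sub (rc_head _) (rc_exp rR (rc_const _ 2)).
exists N0 => N leN; exists (g [:: N]).
  by have := gP [:: N]; rewrite /P /= ltnNge leN.
move=> i lti; rewrite /r /= isqrtE; first by rewrite addKn.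
by rewrite -addnn; lia.
Qed.

End Search.

(** * Minimal indices *)

Lemma reindexing (phi : numbering) h : rc 1 h ->
  exists psi : numbering, forall e x y, psi e x y <-> phi (h [:: e]) x y.
Proof.
move=> hR; have [c cP] := numberingP phi.
have [d dP] : rc 2 (fun s => h [:: head 0 s]).
  apply: (rc_subst (h := fun s => [:: head 0 s])) hR _ _ => // -[_|//].
  exact: rc_head.
suff psiP : partial_recursive (fun (v : 2.-tuple nat) y =>
    phi (h [:: tnth v ord0]) (tnth v ord_max) y).
  by exists (@Numbering (fun e x y => phi (h [:: e]) x y) psiP).
exists (Comp c (fun i : 'I_2 => if i == ord0 then d else Proj ord_max)) => v y.
have hd : head 0 v = tnth v ord0 by rewrite (tnth_nth 0) nth0.
split=> [phiv | [w wP /cP]].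
  exists [tuple h [:: tnth v ord0]; tnth v ord_max]; last exact/cP.
  move=> i; case: (unliftP ord0 i) => [j|] ->; last by apply/dP; rewrite hd.
  by rewrite ord1 /=; congr (tnth v); apply: val_inj.
have /dP -> := wP ord0; have -> := wP ord_max.
by rewrite hd.
Qed.

Lemma minimal_index (phi : numbering) e F :
  same_pfun (phi e) F -> exists m, [/\ m <= e, MIN phi m & same_pfun (phi m) F].
Proof.
move=> eF; have exm : exists m, decide (same_pfun (phi m) F).
  by exists e; apply/decideP.
case: (ex_minnP exm) => m /decideP mF minm; exists m; split=> //.
  exact/minm/decideP.
move=> j ltjm jm; suff /decideP/minm : same_pfun (phi j) F by rewrite leqNgt ltjm.
by move=> x y; rewrite jm.
Qed.

(** The constants [0], ..., [n] have distinct minimal indices of at most [c * n + c]. If this is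
    below [M], then [MIN] has more than [n] elements below [M]. *)
Lemma MIN_density (phi : numbering) : Kolmogorov_property phi ->
  exists2 c, 0 < c &
    forall M, M <= c * (count (fun e => decide (MIN phi e)) (iota 0 M)).+1.
Proof.
move=> hphi.
have constP : partial_recursive (fun (v : 2.-tuple nat) y => y = tnth v ord0).
  by exists (Proj ord0).
have [c c_gt0 [f fP]] := hphi (@Numbering (fun e _ y => y = e) constP).
exists c => // M; set n := count _ _; rewrite leqNgt; apply/negP => ltM.
have [g gP] : exists g, forall e,
    [/\ g e <= f e, MIN phi (g e) & same_pfun (phi (g e)) (fun _ y => y = e)].
  apply: (choice (fun e m =>
    [/\ m <= f e, MIN phi m & same_pfun (phi m) (fun _ y => y = e)])).
  by move=> e; apply: minimal_index; have [] := fP e.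
have : size (map g (iota 0 n.+1)) <=
    size [seq e <- iota 0 M | decide (MIN phi e)].
  apply: uniq_leq_size.
    rewrite map_inj_uniq ?iota_uniq // => e e' eqg.
    have [_ _ ge] := gP e; have [_ _ ge'] := gP e'; rewrite -eqg in ge'.
    exact: (proj1 (ge' 0 e) (proj2 (ge 0 e) erefl)).
  move=> y /mapP[e]; rewrite mem_iota => /andP[_ lte] ->.
  have [le_g ming _] := gP e; have [le_f _] := fP e.
  rewrite mem_filter; apply/andP; split; first exact/decideP.
  rewrite mem_iota /= add0n; apply: leq_ltn_trans le_g _.
  by apply: leq_ltn_trans le_f _; apply: leq_ltn_trans ltM; nia.
by rewrite size_map size_iota size_filter ltnn.
Qed.

Theorem theorem3p3 (phi : numbering) (hphi : Kolmogorov_property phi)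
  (k : nat) (hk : 0 < k) : ~ one_out_of_recursive k (MIN phi).
Proof.
case=> f fR fP.
(* The next line takes [a.+1 = 2 * c]: half of the density [1 / c] is given up for the numbers below
   [N ^ 3]. *)
have [c c_gt0 dens] := MIN_density hphi.
have [h hR [N0 hP]] := computable_hitting (2 * c).-1 fR.
have [psi psiE] := reindexing phi hR.
have [d d_gt0 [p pP]] := hphi psi.
pose S e := decide (MIN phi e).
have agS x : agree f S x.
  have [i iP] := fP x; apply/existsP; exists i; apply/eqP.
  by apply/decideP/idP => /iP.
(* [N] exceeds [4 * c] for the density estimate and [4 * d] for the final comparison. *)
pose N := N0 + 4 * c + 4 * d + 1.
have [l hl lP] : exists2 l, hits_all f (2 * c).-1 l N &
    forall i, i < N -> h [:: N ^ 2 + i] = digit (N ^ 4) l i.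
  by apply: hP; rewrite /N; lia.
have large : N ^ 4 <= (2 * c).-1.+1 *
    count (fun y => (N ^ 3 <= y) && S y) (iota 0 (N ^ 4)).
  have le34 : N ^ 3 <= N ^ 4 by rewrite leq_exp2l /N; lia.
  have leS : count S (iota 0 (N ^ 4)) <=
      N ^ 3 + count (fun y => (N ^ 3 <= y) && S y) (iota 0 (N ^ 4)).
    rewrite -(subnKC le34) iotaD !count_cat.
    apply: leq_add; first by rewrite -[leqRHS](size_iota 0) count_size.
    apply: leq_trans (leq_addl _ _); apply: eq_leq; apply: eq_in_count => y.
    by rewrite mem_iota => /andP[-> _].
  have := dens (N ^ 4); rewrite -/S prednK ?muln_gt0 // => dens4.
  have : 4 * c * N ^ 3 <= N ^ 4 by rewrite (expnS N 3) leq_mul2r /N; lia.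
  have : 0 < N ^ 3 by rewrite expn_gt0 /N; lia.
  move: dens4 leS; move: (N ^ 4) (N ^ 3) (count _ _) (count _ _) => M Q u v.
  nia.
have [|i ltiN /andP[ge3 /decideP min_y]] := hits_allP _ hl agS large.
  by rewrite /N; lia.
rewrite -lP // in ge3 min_y.
(* The point [h [:: N ^ 2 + i]] is a minimal index of at least [N ^ 3], yet its function also has an
   index of at most [d * (N ^ 2 + i) + d <= 2 * d * N ^ 2]. *)
have [le_p p_psi] := pP (N ^ 2 + i).
apply: (min_y (p (N ^ 2 + i))); last first.
  by move=> x y; rewrite p_psi psiE.
apply: leq_ltn_trans le_p _; apply: leq_trans ge3.
have : 4 * d * N ^ 2 < N ^ 3.
  by rewrite (expnS N 2) ltn_mul2r expn_gt0 /N; lia.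
have : N <= N ^ 2 by rewrite -[leqLHS]expn1 leq_exp2l /N; lia.
move: ltiN d_gt0; have : 0 < N by rewrite /N; lia.
move: (N ^ 3) (N ^ 2) (N) => Q R n; nia.
Qed.
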